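(* For positive integers $d \le n$, let $K(n,d)$ denote the maximum diameter of $d$-dimensional subset partition graphs with $n$ symbols satisfying the strong adjacency, endpoint-count, and one-subset properties. There is a universal constant $\kappa > 0$ such that for infinitely many $d$, the inequality \[ \frac{K(n,d)}{n^{d/4}} \geq \kappa \] holds for infinitely many $n$.
   Context: Subset partition graph: Let $S$ be a finite set of cardinality $n$ (the symbol set; its elements are called symbols), and let $\mathcal{A} \subseteq \binom{S}{d}$ be a set of $d$-element subsets of $S$. Let $G = (\mathcal{V},E)$ be a connected graph with vertex set $\mathcal{V} = \{\mathcal{V}_0,\ldots,\mathcal{V}_t\}$, where $\mathcal{V}$ is a partition of $\mathcal{A}$, i.e. (1) $\mathcal{A} = \mathcal{V}_0 \cup \cdots \cup \mathcal{V}_t$, (2) $\mathcal{V}_i \cap \mathcal{V}_j = \emptyset$ if $i \neq j$, and (3) $\mathcal{V}_i \neq \emptyset$ for all $i$. Then $G$ is called a $d$-dimensional subset partition graph of $\mathcal{A}$ on the symbol set $S$ (with $n = |S|$ symbols). Its diameter is the diameter of the graph $G$. Properties of a $d$-dimensional subset partition graph $G$ of $\mathcal{A}$ on $S$: Adjacency: if $A, A' \in \mathcal{A}$ and $|A \cap A'| = d-1$, then $A$ and $A'$ are in the same or adjacent vertices of $G$. Strong adjacency: adjacency holds and, if two vertices $\mathcal{V}_i$ and $\mathcal{V}_j$ are adjacent in $G$, then there are $d$-sets $A \in \mathcal{V}_i$ and $A' \in \mathcal{V}_j$ such that $|A \cap A'| = d-1$. Endpoint-count: if $F \in \binom{S}{d-1}$,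 then $|\{A \in \mathcal{A} : F \subset A\}| \leq 2$. One-subset: $|\mathcal{V}_i| = 1$ for each $i = 0, \ldots, t$. *)

(* Defs.v *)
From HB Require Import structures.
From mathcomp Require Import all_boot all_order all_algebra.
From mathcomp Require Import reals exp.

Set Implicit Arguments.
Unset Strict Implicit.
Unset Printing Implicit Defensive.

Local Open Scope nat_scope.

Section Distance.
Variables (X : finType) (e : rel X).

Definition has_walk (x y : X) (k : nat) : bool :=
  [exists p : k.-tuple X, path e x p && (last x p == y)].

(* Length of a shortest walk from x to y. A shortest walk has fewer than #|X|
   edges, so the search is exhaustive; the value is #|X| when y is not
   reachable from x. *)
Definition gdist (x y : X) : nat := find (has_walk x y) (iota 0 #|X|).

Lemma has_walkP x y k :
  reflect (exists2 p : seq X, path e x p /\ last x p = y & size p = k)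
          (has_walk x y k).
Proof.
apply: (iffP existsP) => [[p /andP[ep /eqP lp]]|[p [ep lp] sp]].
  by exists p; rewrite ?size_tuple.
move/eqP: sp => sp; exists (Tuple sp).
by rewrite /= ep lp eqxx.
Qed.

Lemma gdist_le x p : path e x p -> gdist x (last x p) <= size p.
Proof.
move=> ep; rewrite leqNgt; apply/negP => lt_p.
have sz : size p < #|X|.
  by apply: (leq_trans lt_p); rewrite /gdist -[leqRHS](size_iota 0) find_size.
have := before_find 0 lt_p; rewrite nth_iota // add0n => /negbT/negP; apply.
by apply/has_walkP; exists p.
Qed.

Lemma gdist_walk x y : connect e x y -> has_walk x y (gdist x y).
Proof.
case/connectP => p ep ->; case/shortenP: ep => q eq uq _.
have sz : size q < #|X|.
  by rewrite -[(size q).+1]/(size (x :: q)) -(card_uniqP uq) max_card.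
have hasq : has (has_walk x (last x q)) (iota 0 #|X|).
  apply/hasP; exists (size q); first by rewrite mem_iota.
  by apply/has_walkP; exists q.
have := nth_find 0 hasq; rewrite nth_iota ?add0n //.
by rewrite -[ltnRHS](size_iota 0) -has_find.
Qed.

End Distance.

Section SubsetPartitionGraph.
Variables (S : finType) (d : nat).

(* The triple (A, V, E): a family A of subsets of S, a set V of vertices, each
   vertex being itself a set of subsets of S, and a set E of edges, an edge
   being the set of its two endpoints. *)
Definition spg_data : Type :=
  {set {set S}} * {set {set {set S}}} * {set {set {set {set S}}}}.

Definition dfamily (D : spg_data) := D.1.1.
Definition vertices (D : spg_data) := D.1.2.
Definition edges (D : spg_data) := D.2.

Definition adjacent (D : spg_data) : rel {set {set S}} :=
  fun v w => [set v; w] \in edges D.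

Definition is_spg (D : spg_data) : bool :=
  [&& [forall A in dfamily D, #|A| == d],
      partition (vertices D) (dfamily D),
      vertices D != set0,
      [forall u in edges D, (u \subset vertices D) && (#|u| == 2)] &
      [forall v in vertices D, forall w in vertices D,
         connect (adjacent D) v w]].

Record spg : Type := Spg { spg_val :> spg_data; _ : is_spg spg_val }.

HB.instance Definition _ := [isSub for spg_val].
HB.instance Definition _ := [Finite of spg by <:].

Definition diameter (G : spg) : nat :=
  \max_(v in vertices G) \max_(w in vertices G) gdist (adjacent G) v w.

Definition adjacency (G : spg) : bool :=
  [forall v in vertices G, forall w in vertices G,
   forall A in v, forall A' in w,
     (#|A :&: A'| == d - 1) ==> (v == w) || adjacent G v w].

Definition strong_adjacency (G : spg) : bool :=
  adjacency G &&
  [forall v in vertices G, forall w in vertices G,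
     adjacent G v w ==>
       [exists A in v, exists A' in w, #|A :&: A'| == d - 1]].

Definition endpoint_count (G : spg) : bool :=
  [forall F : {set S}, (#|F| == d - 1) ==>
     (#|[set A in dfamily G | F \subset A]| <= 2)].

Definition one_subset (G : spg) : bool :=
  [forall v in vertices G, #|v| == 1].

End SubsetPartitionGraph.

Definition admissible (n d : nat) (G : spg 'I_n d) : bool :=
  [&& strong_adjacency G, endpoint_count G & one_subset G].

(* Up to renaming symbols, the symbol set is 'I_n. The maximum ranges over a
   finite type, and over a nonempty set of graphs when 0 < d <= n. *)
Definition K (n d : nat) : nat := \max_(G : spg 'I_n d | admissible G) diameter G.

Lemma admissible_ex n d : 0 < d <= n -> exists G : spg 'I_n d, admissible G.
Proof.
case/andP=> d_gt0 le_dn.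
pose A := [set i : 'I_n | i < d].
have cA : #|A| = d.
  have -> : A = [set widen_ord le_dn i | i : 'I_d].
    apply/setP => i; rewrite inE; apply/idP/imsetP => [lt_i|[j _ ->]] //=.
    by exists (Ordinal lt_i) => //; apply: val_inj.
  by rewrite card_imset ?card_ord // => i j /(congr1 val) /= /val_inj.
pose D : spg_data 'I_n := ([set A], [set [set A]], set0).
have PD : is_spg d D.
  apply/and5P; split.
  - by apply/'forall_implyP => B /set1P ->; rewrite cA.
  - rewrite /partition /cover big_set1 eqxx trivIset1 /= inE eq_sym.
    by apply/set0Pn; exists A; rewrite inE.
  - by apply/set0Pn; exists [set A]; rewrite inE.
  - by apply/'forall_implyP => u; rewrite inE.
  apply/'forall_implyP => v /set1P ->.
  by apply/'forall_implyP => w /set1P ->; apply: connect0.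
exists (Spg PD); apply/and3P; split.
- apply/andP; split.
    apply/'forall_implyP => v /set1P ->; apply/'forall_implyP => w /set1P ->.
    apply/'forall_implyP => B _; apply/'forall_implyP => B' _.
    by rewrite eqxx implybT.
  apply/'forall_implyP => v _; apply/'forall_implyP => w _.
  by rewrite /adjacent inE.
- apply/forallP => F; apply/implyP => _.
  apply: (@leq_trans #|[set A]|); last by rewrite cards1.
  by apply/subset_leq_card/subsetP => B; rewrite inE => /andP[].
by apply/'forall_implyP => v /set1P ->; rewrite cards1.
Qed.

Lemma K_attained n d : 0 < d <= n ->
  exists2 G : spg 'I_n d, admissible G & diameter G = K n d.
Proof.
move=> /admissible_ex[G0 G0P].
have /(eq_bigmax_cond (@diameter _ d)) [G GP eK] :
    0 < #|[pred G : spg 'I_n d | admissible G]|.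
  by apply/card_gt0P; exists G0.
by exists G => //; rewrite /K -eK.
Qed.

(* Main.v *)
(** The graph condition holds for every induced path of the Johnson graph
    J(n, d): an induced path contains no triangle, hence no three d-sets through
    a common (d-1)-set. So K(n, d) is at least the length of an induced path.
    The edges of a path in the complete graph on 2M points form an induced path
    of J(2M, 2). The union of d-sets on disjoint symbol sets embeds the
    Cartesian product of two Johnson graphs as an induced subgraph of a third,
    and a grid with N columns and 2M - 1 rows contains an induced path with at
    least M N vertices, which sweeps every other row. Iterating 2j times gives
    an induced path with M^(2j) vertices in J(4jM, 4j), and
    M^(2j) - 1 >= (4jM)^j as soon as M > 4j. *)
Require Import Defs.
From mathcomp Require Import all_boot all_order all_algebra.
From mathcomp Require Import reals exp.
From mathcomp Require Import zify.

Import Order.TTheory GRing.Theory Num.Theory.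

Local Open Scope ring_scope.

Section Snakes.
Local Open Scope nat_scope.

(** * Induced paths in Johnson graphs *)

Definition ndist (i j : nat) := (i - j) + (j - i).

(** Here [N] counts vertices, not edges. The case [i = j] of the first clause forces every [s i] to
    have [d] elements. *)
Definition johnson_snake {n} d N (s : nat -> {set 'I_n}) := forall i j,
  i < N -> j < N ->
  (ndist i j <= 1 -> #|s i :&: s j| + ndist i j = d) /\
  (1 < ndist i j -> #|s i :&: s j| + 2 <= d).

Lemma edge_snake m : 0 < m -> exists s, @johnson_snake m 2 m.-1 s.
Proof.
case: m => // m _; exists (fun b => [set inord b; inord b.+1]) => /=.
have inordE i j : i < m.+1 -> j < m.+1 ->
    ((inord i : 'I_m.+1) == inord j) = (i == j).
  by move=> lti ltj; rewrite -val_eqE /= !inordK.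
move=> i j lt_i lt_j.
wlog le_ij : i j lt_i lt_j / i <= j => [wl|].
  case: (leqP i j) => [|/ltnW] le; first exact: wl.
  by rewrite setIC /ndist addnC; apply: wl.
case: (ltngtP j i.+1) => [lt|gt|def_j].
- have -> : j = i by lia.
  by rewrite setIid cards2 inordE /ndist; lia.
- have -> : [set inord i; inord i.+1] :&: [set inord j; inord j.+1] =
            set0 :> {set 'I_m.+1}.
    apply/setP => x; rewrite !inE; apply/negbTE/negP.
    by case/andP => /orP[] /eqP -> /orP[]; rewrite inordE; lia.
  by rewrite cards0 /ndist; lia.
rewrite {j le_ij}def_j in lt_j *.
have -> : [set inord i; inord i.+1] :&: [set inord i.+1; inord i.+2] =
          [set inord i.+1] :> {set 'I_m.+1}.
  apply/setP => x; rewrite !inE; apply/idP/idP => [|->]; last by rewrite orbT.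
  by case/andP => /orP[] /eqP -> /orP[]; rewrite !inordE //; lia.
by rewrite cards1 /ndist; lia.
Qed.

(** * Products and the sweep of a grid *)

Definition join_set {n m} (A : {set 'I_n}) (B : {set 'I_m}) : {set 'I_(n + m)} :=
  [set x | match split x with inl a => a \in A | inr b => b \in B end].

Lemma join_setI n m (A A' : {set 'I_n}) (B B' : {set 'I_m}) :
  join_set A B :&: join_set A' B' = join_set (A :&: A') (B :&: B').
Proof. by apply/setP => x; rewrite !inE; case: split => y; rewrite inE. Qed.

Lemma card_join_set n m (A : {set 'I_n}) (B : {set 'I_m}) :
  #|join_set A B| = #|A| + #|B|.
Proof.
rewrite -!sum1_card big_split_ord /=; congr (_ + _); apply: eq_bigl => x.
  by rewrite inE -[lshift m x]/(unsplit (inl x)) unsplitK.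
by rewrite inE -[rshift n x]/(unsplit (inr x)) unsplitK.
Qed.

(* Boustrophedon: row 2q is swept rightwards or leftwards according to the
   parity of q, and column N - 1 or 0 then leads through row 2q + 1. *)
Definition sweep_row N t := (t %/ N.+1).*2 + (t %% N.+1 == N).
(** The cap at [N.-1] holds the column still at the last time of each block of [N.+1], which is
    spent in the odd row. *)
Definition sweep_col N t :=
  let a := minn (t %% N.+1) N.-1 in if odd (t %/ N.+1) then N.-1 - a else a.

Lemma sweep_col_lt N t : 0 < N -> sweep_col N t < N.
Proof. by rewrite /sweep_col; case: ifP => _; lia. Qed.

(** A sweep of all [M] even rows visits [M * N + (M - 1)] points, connecting ones included. So
    before time [M * N] the last block never reaches its connecting row. *)
Lemma sweep_row_lt M N t : t < M * N -> sweep_row N t < M.*2.-1.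
Proof.
move=> lt_t; rewrite /sweep_row.
have := divn_eq t N.+1; have : t %% N.+1 < N.+1 by rewrite ltn_mod.
move: (t %/ N.+1) (t %% N.+1) => q r lt_r def_t.
have lt_q : q < M.
  by rewrite ltnNge; apply/negP => /leq_mul/(_ (leqnn N)); lia.
case: eqP => [def_r|_] /=; last by lia.
have [|def_M] : q.+1 < M \/ M = q.+1; [by lia | by lia |].
by rewrite def_M in lt_t; lia.
Qed.

(** [D] is the grid distance. Inside a block the motion is monotone. Blocks at least two apart are
    at least three rows apart. For consecutive blocks only the connecting point lies within one row
    of the next even row, and the reversed direction starts that row in the same column. *)
Lemma sweep_induced N t u : 0 < N ->
  let D := ndist (sweep_col N t) (sweep_col N u) +
           ndist (sweep_row N t) (sweep_row N u) in
  (ndist t u <= 1 -> D = ndist t u) /\ (1 < ndist t u -> 1 < D).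
Proof.
move=> N_gt0; wlog le_tu : t u / t <= u => [wl|].
  case: (leqP t u) => [|/ltnW] le; first exact: wl.
  by have := wl u t le; rewrite /ndist /=; lia.
have := leq_div2r N.+1 le_tu; rewrite /sweep_row /sweep_col.
have := divn_eq t N.+1; have := divn_eq u N.+1.
have : t %% N.+1 < N.+1 by rewrite ltn_mod.
have : u %% N.+1 < N.+1 by rewrite ltn_mod.
move: (t %/ N.+1) (t %% N.+1) (u %/ N.+1) (u %% N.+1) => q r q' r'.
move=> lt_r' lt_r def_u def_t le_q.
case: (ltngtP q' q.+1) => [lt|gt|def_q'].
- have eq_q : q' = q by lia.
  rewrite {q' lt le_q}eq_q in def_u *; move: (q * N.+1) def_u def_t => Q.
  by rewrite /ndist /=; case: odd; do 2!case: eqP => ? /=; lia.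
- have le2 : q.+2 * N.+1 <= q' * N.+1 by rewrite leq_mul2r gt orbT.
  rewrite !mulSn in le2; rewrite /ndist /=.
  by case: eqP => ?; case: eqP => ? /=; lia.
rewrite {q' le_q}def_q' mulSn /= in def_u *.
move: (q * N.+1) def_u def_t => Q.
by rewrite /ndist /=; case: odd => /=; do 2!case: eqP => ? /=; lia.
Qed.

(** The deficits [d - #|A :&: A'|] add under [join_set]. In each factor the deficit equals the index
    distance up to 1 and is at least 2 beyond, so the sum relates to the grid distance in the same
    way. *)
Lemma join_snake n1 d1 N s1 n2 d2 M s2 : 0 < N ->
  @johnson_snake n1 d1 N s1 -> @johnson_snake n2 d2 M.*2.-1 s2 ->
  johnson_snake (d1 + d2) (M * N)
    (fun t => join_set (s1 (sweep_col N t)) (s2 (sweep_row N t))).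
Proof.
move=> N_gt0 snake1 snake2 t u lt_t lt_u.
rewrite join_setI card_join_set.
have := snake1 _ _ (sweep_col_lt N t N_gt0) (sweep_col_lt N u N_gt0).
have := snake2 _ _ (sweep_row_lt M N _ lt_t) (sweep_row_lt _ _ _ lt_u).
have /= := sweep_induced N t u N_gt0.
move: #|_| #|_| (ndist (sweep_col _ _) _) (ndist (sweep_row _ _) _) => *.
by lia.
Qed.

Lemma power_snake M k : 0 < M ->
  exists s, @johnson_snake (k * M.*2) k.*2 (M ^ k) s.
Proof.
move=> M_gt0; elim: k => [|k [s snake_s]].
  (* The one-vertex path in J(0, 0). *)
  exists (fun=> set0) => i j lt_i lt_j.
  by rewrite setI0 cards0 /ndist; rewrite expn0 in lt_i lt_j; lia.
(* The path on [M.*2] points has [M.*2.-1] edges, exactly the rows that [join_snake] asks for. *)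
have [|s2 snake2] := edge_snake M.*2; first by rewrite double_gt0.
have Mk_gt0 : 0 < M ^ k by rewrite expn_gt0 M_gt0.
have := join_snake _ _ _ _ _ _ _ _ Mk_gt0 snake_s snake2.
rewrite -expnS addn2 -doubleS => snake'.
by rewrite mulSnr; eexists; exact: snake'.
Qed.

(** * The subset partition graph of an induced path *)

Section SnakeGraph.
Variables (n d L : nat) (s : nat -> {set 'I_n}).
Hypothesis snake_s : johnson_snake d L.+1 s.

Lemma snake_card i : i <= L -> #|s i| = d.
Proof.
move=> le_i; have [+ _] := snake_s i i le_i le_i.
by rewrite setIid /ndist subnn !addn0; apply.
Qed.

Lemma snake_inj i j : i <= L -> j <= L -> s i = s j -> i = j.
Proof.
move=> le_i le_j eq_s; have := snake_s i j le_i le_j.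
by rewrite eq_s setIid snake_card // /ndist; lia.
Qed.

(** For [d = 0] the truncated [d - 1] is 0 and all intersections are empty, whence the second
    disjunct. *)
Lemma snake_adj i j : i <= L -> j <= L ->
  (#|s i :&: s j| == d - 1) = (ndist i j == 1) || (d == 0).
Proof.
move=> le_i le_j; have := snake_s i j le_i le_j.
by move=> ?; lia.
Qed.

Definition snake_data : spg_data 'I_n :=
  ([set s (val i) | i : 'I_L.+1], [set [set s (val i)] | i : 'I_L.+1],
   [set [set [set s (val i)]; [set s i.+1]] | i : 'I_L]).

Lemma snake_verticesP v :
  reflect (exists2 i, i <= L & v = [set s i]) (v \in vertices snake_data).
Proof.
apply: (iffP imsetP) => [[i _ ->]|[i le_i ->]].
  by exists i; rewrite // -ltnS.
by exists (Ordinal (le_i : i < L.+1)).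
Qed.

Lemma snake_familyP B :
  reflect (exists2 i, i <= L & B = s i) (B \in dfamily snake_data).
Proof.
apply: (iffP imsetP) => [[i _ ->]|[i le_i ->]].
  by exists i; rewrite // -ltnS.
by exists (Ordinal (le_i : i < L.+1)).
Qed.

Lemma snake_adjacent i j : i <= L -> j <= L ->
  adjacent snake_data [set s i] [set s j] = (ndist i j == 1).
Proof.
have adjS k : k < L -> adjacent snake_data [set s k] [set s k.+1].
  by move=> lt_k; apply/imsetP; exists (Ordinal lt_k).
move=> le_i le_j; apply/idP/idP => [/imsetP[[k lt_k] _ /= /setP eq_e]|/eqP dist1].
  have eqE a b : a <= L -> b <= L -> ([set s a] == [set s b]) = (a == b).
    move=> le_a le_b; apply/eqP/eqP => [/set1_inj|-> //].
    exact: snake_inj.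
  (* Testing the four endpoints for membership turns the equality of the two edges into arithmetic
     on indices. *)
  have := eq_e [set s k]; have := eq_e [set s k.+1].
  have := eq_e [set s i]; have := eq_e [set s j].
  by rewrite !inE !eqE ?(ltnW lt_k) // /ndist; lia.
have [ej|ei] : j = i.+1 \/ i = j.+1 by rewrite /ndist in dist1; lia.
  by rewrite ej; apply: adjS; lia.
by rewrite /adjacent setUC ei; apply: adjS; lia.
Qed.

Lemma snake_connect i j : i <= L -> j <= L ->
  connect (adjacent snake_data) [set s i] [set s j].
Proof.
have from0 k : k <= L -> connect (adjacent snake_data) [set s 0] [set s k].
  elim: k => [|k IHk] le_k; first exact: connect0.
  apply: connect_trans (IHk (ltnW le_k)) (connect1 _).
  by rewrite snake_adjacent ?(ltnW le_k) // /ndist; lia.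
have sym : connect_sym (adjacent snake_data).
  by apply: sym_connect_sym => v w; rewrite /adjacent setUC.
move=> le_i le_j; apply: connect_trans (from0 _ le_j).
by rewrite sym from0.
Qed.

Lemma snake_is_spg : is_spg d snake_data.
Proof.
apply/and5P; split.
- by apply/'forall_implyP => B /snake_familyP[i le_i ->]; rewrite snake_card.
- apply/and3P; split.
  + apply/eqP/setP => B; apply/bigcupP/snake_familyP.
      by case=> v /snake_verticesP[i le_i ->] /set1P ->; exists i.
    case=> i le_i ->; exists [set s i]; last exact: set11.
    by apply/snake_verticesP; exists i.
  + apply/trivIsetP => v w /snake_verticesP[i _ ->] /snake_verticesP[j _ ->].
    by move=> neq; rewrite disjoints1 inE; apply: contraNneq neq => ->.
  by apply/snake_verticesP => -[i _] /setP/(_ (s i)); rewrite !inE eqxx.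
- by apply/set0Pn; exists [set s 0]; apply/snake_verticesP; exists 0.
- apply/'forall_implyP => _ /imsetP[k _ ->]; have lt_k := ltn_ord k.
  apply/andP; split.
    apply/subsetP => v /set2P[] ->; apply/snake_verticesP.
      by exists k; rewrite // ltnW.
    by exists k.+1.
  rewrite cards2; case: ([set s (val k)] =P _) => // /set1_inj eq_s.
  by have := snake_inj _ _ (ltnW lt_k) lt_k eq_s; lia.
apply/'forall_implyP => v /snake_verticesP[i le_i ->].
by apply/'forall_implyP => w /snake_verticesP[j le_j ->]; apply: snake_connect.
Qed.

Definition snake_graph : spg 'I_n d := Spg snake_is_spg.

Lemma snake_admissible : 0 < d -> admissible snake_graph.
Proof.
move=> d_gt0; have adjE i j : i <= L -> j <= L ->
    (#|s i :&: s j| == d - 1) = (ndist i j == 1).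
  by move=> le_i le_j; rewrite snake_adj // [d == 0]gtn_eqF ?orbF.
apply/and3P; split.
- apply/andP; split.
    apply/'forall_implyP => v /snake_verticesP[i le_i ->].
    apply/'forall_implyP => w /snake_verticesP[j le_j ->].
    apply/'forall_implyP => B /set1P ->; apply/'forall_implyP => B' /set1P ->.
    by apply/implyP; rewrite adjE // snake_adjacent // => ->; rewrite orbT.
  apply/'forall_implyP => v /snake_verticesP[i le_i ->].
  apply/'forall_implyP => w /snake_verticesP[j le_j ->].
  rewrite snake_adjacent // -adjE //; apply/implyP => adj.
  apply/'exists_andP; exists (s i); split; first exact: set11.
  by apply/'exists_andP; exists (s j); split; first exact: set11.
- apply/forallP => F; apply/implyP => /eqP cF; rewrite leqNgt.
  apply/negP => /card_gt2P[A1 [A2 [A3 [[]]]]].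
  rewrite !inE => /andP[/snake_familyP[i le_i {A1}->] sFi].
  case/andP=> /snake_familyP[j le_j {A2}->] sFj.
  case/andP=> /snake_familyP[k le_k {A3}->] sFk [].
  (* Distinct members containing [F] share at least [d - 1] elements, so their indices differ by 1;
     three naturals cannot pairwise differ by 1. *)
  have dist1 a b : a <= L -> b <= L -> F \subset s a -> F \subset s b ->
      s a != s b -> ndist a b = 1.
    move=> le_a le_b sFa sFb neq.
    have neq_ab : a <> b by move=> eq_ab; rewrite eq_ab eqxx in neq.
    have : #|F| <= #|s a :&: s b| by rewrite subset_leq_card // subsetI sFa.
    by have := snake_s a b le_a le_b; move: neq_ab; rewrite /ndist; lia.
  move=> /dist1 dij /dist1 djk /dist1 dki.
  move: (dij le_i le_j sFi sFj) (djk le_j le_k sFj sFk) (dki le_k le_i sFk sFi).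
  by rewrite /ndist; lia.
by apply/'forall_implyP => v /snake_verticesP[i _ ->]; rewrite cards1.
Qed.

(** Each edge raises the index by at most one. *)
Lemma snake_path_size i p j : i <= L -> j <= L ->
  path (adjacent snake_data) [set s i] p -> last [set s i] p = [set s j] ->
  j <= i + size p.
Proof.
elim: p i => [|v p IHp] i le_i le_j /=.
  by move=> _ /set1_inj /snake_inj ->; rewrite ?addn0.
case/andP=> adj path_p last_p.
have /snake_verticesP[k le_k def_v] : v \in vertices snake_data.
  have /and5P[_ _ _ /'forall_implyP edgeP _] := snake_is_spg.
  have /andP[/subsetP sub _] := edgeP _ adj.
  by apply: sub; rewrite !inE eqxx orbT.
rewrite {v}def_v in adj path_p last_p.
have := IHp k le_k le_j path_p last_p.
by move: adj; rewrite snake_adjacent // /ndist; lia.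
Qed.

Lemma snake_diameter : L <= diameter snake_graph.
Proof.
have vE k : k <= L -> [set s k] \in vertices snake_graph.
  by move=> le_k; apply/snake_verticesP; exists k.
apply: leq_trans (leq_bigmax_cond _ (vE 0 isT)).
apply: leq_trans (leq_bigmax_cond _ (vE L (leqnn L))).
have /gdist_walk/has_walkP[p [path_p last_p] <-] :=
  snake_connect 0 L isT (leqnn L).
exact: (snake_path_size 0 p L).
Qed.

End SnakeGraph.

(** * Lower bounds on [K] *)

Lemma K_ge_snake n d L s : 0 < d -> @johnson_snake n d L.+1 s -> L <= K n d.
Proof.
move=> d_gt0 snake_s; apply: leq_trans (snake_diameter _ _ _ _ snake_s) _.
by apply: (@leq_bigmax_cond _ _ (@diameter _ d)); apply: snake_admissible.
Qed.

Lemma K_ge_expn M j : 0 < j -> 4 * j < M ->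
  (j.*2 * M.*2) ^ j <= K (j.*2 * M.*2) (4 * j).
Proof.
move=> j_gt0 lt_jM; have M_gt0 : 0 < M by lia.
have [s snake_s] := power_snake M j.*2 M_gt0.
have -> : 4 * j = j.*2.*2 by lia.
apply: (@leq_trans (M ^ j.*2).-1); last first.
  apply: (@K_ge_snake _ _ _ s); first by lia.
  by rewrite prednK // expn_gt0 M_gt0.
have -> : j.*2 * M.*2 = 4 * j * M by lia.
(* The predecessor makes the inequality strict; cancelling [M ^ j] leaves [(4 * j) ^ j < M ^ j]. *)
rewrite -ltnS prednK ?expn_gt0 ?M_gt0 // -addnn expnD expnMn ltn_mul2r.
by rewrite expn_gt0 M_gt0 ltn_exp2r.
Qed.

End Snakes.

Theorem theorem4p4 (R : realType) :
  exists2 kappa : R, 0 < kappa &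
    forall d0 : nat, exists d : nat, [/\ (d0 <= d)%N, (0 < d)%N &
      forall n0 : nat, exists n : nat, [/\ (n0 <= n)%N, (d <= n)%N &
        (K n d)%:R / (n%:R `^ (d%:R / 4%:R)) >= kappa]].
Proof.
(* A multiple of 4 makes the exponent [d / 4] the natural number [j], so the real power becomes an
   ordinary one. *)
exists 1 => // d0; pose j := d0.+1; exists (4 * j)%N.
split; [by lia | by lia | move=> n0].
(* [M] exceeds [4 * j], as [K_ge_expn] requires, and also [n0], so that [n >= M] is large enough. *)
pose M := (4 * j + n0).+1; exists (j.*2 * M.*2)%N.
have le_n : (M <= j.*2 * M.*2)%N by rewrite /j /M; nia.
have n_gt0 : (0 < j.*2 * M.*2)%N by lia.
split; [by lia | by lia |].
have -> : (4 * j)%:R / 4%:R = j%:R :> R.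
  by rewrite natrM mulrAC divff ?mul1r // pnatr_eq0.
rewrite powR_mulrn ?ler0n // ler_pdivlMr ?exprn_gt0 ?ltr0n // mul1r.
by rewrite -natrX ler_nat K_ge_expn //; lia.
Qed.
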